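(* Fix $t\in\mathbb{N}$. For any $\epsilon\in(0,1/\sqrt{e})$ there is $n(\epsilon)$ such that for all $n>n(\epsilon)$, every $t$-intersecting family $\mathcal{F}\subseteq\mathcal{M}_{2n}$ with $|\mathcal{F}| > (1-1/\sqrt{e}+\epsilon)(2(n-t)-1)!!$ is contained in a canonically $t$-intersecting family, i.e. there is a set $T$ of $t$ pairwise disjoint edges of $K_{2n}$ with $T\subseteq m$ for every $m\in\mathcal{F}$.
   Context: $\mathcal{M}_{2n}$ is the set of perfect matchings of the complete graph $K_{2n}$. A family $\mathcal{F}\subseteq\mathcal{M}_{2n}$ is $t$-intersecting if $|m\cap m'|\ge t$ for all $m,m'\in\mathcal{F}$. The canonically $t$-intersecting family of a set $T$ of $t$ disjoint edges is $\{m\in\mathcal{M}_{2n}: T\subseteq m\}$. $(2k-1)!!=1\cdot3\cdots(2k-1)$. *)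

(* Defs.v *)
From mathcomp Require Import all_boot.
From Stdlib Require Import Reals.
Set Implicit Arguments. Unset Strict Implicit. Unset Printing Implicit Defensive.

Definition edge_of (n : nat) (e : {set 'I_(2 * n)}) : bool := #|e| == 2.

Definition perfect_matching (n : nat) (m : {set {set 'I_(2 * n)}}) : bool :=
  [forall e in m, edge_of e] &&
  [forall v : 'I_(2 * n), #|[set e in m | v \in e]| == 1].

Definition t_intersecting (n t : nat) (F : {set {set {set 'I_(2 * n)}}}) : bool :=
  [forall m in F, forall m' in F, t <= #|m :&: m'|].

(* oddfact k = 1 * 3 * ... * (2k-1) = (2k-1)!!  (oddfact 0 = 1 = (-1)!!) *)
Definition oddfact (k : nat) : nat := \prod_(i < k) (2 * i + 1).

(* Main.v *)
(* Call S a cover of F if every member of F shares at least t edges with S.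
   Branching on the at most n edges of a member that violates the cover condition
   shows that the members of F containing no cover of size at most s number at most
   n^s (2(n-s)-1)!!, which is about 2^-s (2n-1)!! and hence negligible once s is a
   large multiple of log n.
   Some cover has size at most s.  If each of its t-subsets T misses an edge of some
   small cover, then a second branching gives |F| <= s^(t+1) (2(n-t)-3)!!, again
   negligible.  Otherwise one T lies in all small covers, and thus in nearly all
   members of F.  If a member m0 does not contain T, then each member that does
   meets m0 outside T; the matchings through T avoiding m0 make up a proportion of
   at least (1 - 1/(2N-1))^N = 1/sqrt(e) - o(1), N = n - t, since forbidding one
   further edge costs at most a proportion 1/(2N-1) of what remains. *)

Require Import Defs.
From mathcomp Require Import all_boot zify.
From Stdlib Require Import Reals Lra.
(* Reals rebinds the power notation in nat_scope; this restores expn. *)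
From mathcomp Require Import ssrnat.

Set Implicit Arguments.
Unset Strict Implicit.
Unset Printing Implicit Defensive.

(** * Union bound and the counts of matchings avoiding given edges *)

Lemma leq_card_bigcup (I T : finType) (A : {set I}) (B : I -> {set T}) :
  #|\bigcup_(i in A) B i| <= \sum_(i in A) #|B i|.
Proof.
elim/big_rec2: _ => [|i k U _ leU]; first by rewrite cards0.
by apply: leq_trans (leq_card_setU _ _) _; rewrite leq_add2l.
Qed.

(* The number of perfect matchings of K_{2N} avoiding p given disjoint edges,
   for p <= N; the recursion removes those containing one of the edges. *)
Fixpoint avoid_count (p N : nat) : R :=
  if p is p'.+1 then (avoid_count p' N - avoid_count p' N.-1)%R
  else INR (oddfact N).

Lemma leq_bin_expn m k : 'C(m, k) <= m ^ k.
Proof.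
apply: (@leq_trans (m ^_ k)); first by rewrite -bin_ffact leq_pmulr ?fact_gt0.
elim: k m => [|k IH] m; first by rewrite ffactn0.
rewrite ffactnS expnS leq_mul2l; apply/orP; right.
by apply: leq_trans (IH _) _; case: k {IH} => // k; rewrite leq_exp2r // leq_pred.
Qed.

Lemma oddfactS k : oddfact k.+1 = (2 * k + 1) * oddfact k.
Proof. by rewrite /oddfact big_ord_recr /= mulnC. Qed.

Lemma INR_oddfactS k : INR (oddfact k.+1) = ((2 * INR k + 1) * INR (oddfact k))%R.
Proof. by rewrite oddfactS mult_INR plus_INR mult_INR. Qed.

(** Unlike the defining recursion, this one has no negative coefficient, so lower bounds propagate.
    The case [q.+1] is the difference of two consecutive instances for [q]. *)
Lemma avoid_count_rec q M : q <= M ->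
  avoid_count q.+1 M.+2 = ((2 * INR M + 3) * avoid_count q.+1 M.+1
                           + 2 * (INR q + 1) * avoid_count q M)%R.
Proof.
elim: q M => [|q IH] M leqM.
  by rewrite /= !INR_oddfactS !S_INR; ring.
case: M leqM => // M leqM.
have e1 : avoid_count q.+2 M.+3 =
  (avoid_count q.+1 M.+3 - avoid_count q.+1 M.+2)%R by [].
have e2 : avoid_count q.+2 M.+2 =
  (avoid_count q.+1 M.+2 - avoid_count q.+1 M.+1)%R by [].
have e3 : avoid_count q.+1 M.+1 =
  (avoid_count q M.+1 - avoid_count q M)%R by [].
rewrite e1 IH; last by lia.
rewrite e2 {2}IH // e3 !S_INR; ring.
Qed.

(** The two halves feed each other: growth by [2 * INR N + 1] keeps the next difference nonnegative,
    and the nonnegative last term of [avoid_count_rec] gives the growth. *)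
Lemma avoid_count_ge0_leS p : forall N, p <= N -> (0 <= avoid_count p N /\
  (2 * INR N + 1) * avoid_count p N <= avoid_count p N.+1)%R.
Proof.
elim: p => [|p IH] N lepN.
  by split; [apply: pos_INR|rewrite /= INR_oddfactS; lra].
case: N lepN => // N lepN.
have [h1 h2] := IH N lepN; have pN := pos_INR N; have pp := pos_INR p.
split.
  rewrite [avoid_count _ _]/=; nra.
rewrite avoid_count_rec // S_INR; nra.
Qed.

(** By the growth bound, one more forbidden edge keeps a proportion of at least 2N/(2N+1) = 1/(1+y)
    with y = 1/(2N), and 1/(1+y) >= exp(-y). *)
Lemma avoid_count_ge_exp p N : 0 < N -> p <= N.+1 ->
  (exp (- (INR p / (2 * INR N))) * INR (oddfact N.+1) <= avoid_count p N.+1)%R.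
Proof.
move=> N0; have N1 : (1 <= INR N)%R by apply: (le_INR 1); lia.
elim: p => [|p IH] lep.
  by rewrite /= /Rdiv Rmult_0_l Ropp_0 exp_0; lra.
have [h0 h1] := avoid_count_ge0_leS (lep : p <= N).
have [h2 _] := avoid_count_ge0_leS (ltnW lep).
have {}IH := IH (ltnW lep).
set y := (/ (2 * INR N))%R.
have y0 : (0 < y)%R by apply: Rinv_0_lt_compat; lra.
have Ny : (2 * INR N * y = 1)%R by apply: Rinv_r; lra.
have -> : (- (INR p.+1 / (2 * INR N)) = - y + - (INR p / (2 * INR N)))%R.
  by rewrite S_INR /Rdiv -/y; ring.
rewrite exp_plus Rmult_assoc.
have ey : (exp (- y) * (1 + y) <= 1)%R.
  have := exp_ineq1_le y; have := exp_pos (- y).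
  have : (exp (- y) * exp y = 1)%R by rewrite -exp_plus Rplus_opp_l exp_0.
  nra.
have e0 := exp_pos (- y).
apply: (Rle_trans _ (exp (- y) * avoid_count p N.+1)); first by nra.
rewrite [avoid_count p.+1 _]/=.
set a := avoid_count p N.+1 in h1 h2 *; set b := avoid_count p N in h0 h1 *.
(* multiply by [1 + y = (2 N + 1) y] *)
apply: (Rmult_le_reg_r (1 + y)); first by lra.
have : ((2 * INR N + 1) * b * y <= a * y)%R by nra.
have -> : ((2 * INR N + 1) * b * y = b * (1 + y))%R 
  by transitivity (b * (2 * INR N * y) + b * y)%R; [ring|rewrite Ny; ring].
nra.
Qed.

(** As p <= N+1, the exponent is at least -1/2 - y with y = 1/(2N); then exp(-y) >= 1 - y and
    exp(-1/2) < 1 bound the loss by y. *)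
Lemma avoid_count_ge p N : 0 < N -> p <= N.+1 ->
  ((exp (- (1 / 2)) - / (2 * INR N)) * INR (oddfact N.+1) <= avoid_count p N.+1)%R.
Proof.
move=> N0 lep; apply: Rle_trans (avoid_count_ge_exp N0 lep).
apply: Rmult_le_compat_r; first exact: pos_INR.
have N1 : (1 <= INR N)%R by apply: (le_INR 1); lia.
have lep' : (INR p <= INR N + 1)%R by rewrite -S_INR; apply/le_INR/leP.
set y := (/ (2 * INR N))%R.
have y0 : (0 < y)%R by apply: Rinv_0_lt_compat; lra.
have Ny : (2 * INR N * y = 1)%R by apply: Rinv_r; lra.
apply: (Rle_trans _ (exp (- (1 / 2) + - y))).
  rewrite exp_plus; have := exp_ineq1_le (- y).
  have := exp_pos (- (1 / 2)); have : (exp (- (1 / 2)) < 1)%R.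
    by have := @exp_increasing (- (1 / 2)) 0; rewrite exp_0; apply; lra.
  nra.
have [lt|->] : (- (1 / 2) + - y <= - (INR p / (2 * INR N)))%R.
- have -> : (INR p / (2 * INR N) = INR p * y)%R by [].
  have := Rmult_le_compat_r _ _ _ (Rlt_le _ _ y0) lep'; lra.
- exact/Rlt_le/exp_increasing.
- exact: Rle_refl.
Qed.

(** * Double factorial estimates and the choice of the branching depth *)

Lemma expn_mul_oddfact_le c a j : c <= 2 * (2 * a + 1) ->
  c ^ j * oddfact a <= 2 ^ j * oddfact (a + j).
Proof.
move=> lec; elim: j => [|j IH]; first by rewrite addn0.
rewrite addnS oddfactS !expnS -!mulnA (mulnCA (2 ^ j)).
by rewrite [leqRHS]mulnA; apply: leq_mul IH; lia.
Qed.

(** As s <= n/4, each of the 2d odd factors leading from [oddfact (n - s)] to [oddfact (n - t)] is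
    at least 3n/2. After cancelling n^(2d) there remains n^(t+1) 4^d <= 9^d, which holds because
    n^(t+1) <= 2^d and 8 <= 9. *)
Lemma branching_remainder_le n t L : let s := t + 2 * (t.+1 * L) in
  4 * s <= n -> n <= 2 ^ L -> n * (n ^ s * oddfact (n - s)) <= oddfact (n - t).
Proof.
rewrite /=; set d := t.+1 * L => le4 leL.
have := @expn_mul_oddfact_le (3 * n) (n - (t + 2 * d)) (2 * d).
have -> : n - (t + 2 * d) + 2 * d = n - t by lia.
have hc : 3 * n <= 2 * (2 * (n - (t + 2 * d)) + 1) by lia.
move=> /(_ hc) H.
rewrite -(leq_pmul2l (_ : 0 < 2 ^ (2 * d))) ?expn_gt0 //; apply: leq_trans H.
rewrite !mulnA leq_mul2r; apply/orP; right.
rewrite -mulnA -expnS -addSn expnD expnMn mulnA leq_mul2r; apply/orP; right.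
rewrite -[2 * _ * L]mulnA -/d !(expnM _ 2) -[3 ^ 2]/9 -[2 ^ 2]/4.
apply: (@leq_trans (4 ^ d * 2 ^ d)); last first.
  by rewrite -expnMn; case: (posnP d) => [->|d0] //; rewrite leq_exp2r.
by rewrite leq_mul2l; apply/orP; right; rewrite /d mulnC expnM leq_exp2r.
Qed.

(** A depth of order log n suffices for the remainder bound, and any fixed power of it is eventually
    below n. The parameter [M] makes the error terms a proportion of at most 1/M. *)
Lemma branching_depth t M : exists n0, forall n, n0 < n -> exists s,
  [/\ t <= s, 4 * s <= n, M <= n, M * s ^ t.+1 <= n &
      n * (n ^ s * oddfact (n - s)) <= oddfact (n - t)].
Proof.
(* [k] exceeds the exponent [t.+1] by one: s^(t+1) is at most A^(t+1) 2^(q(t+1)), and the spare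
   factor 2^q in 2^(kq) <= n absorbs [Q]. The 4 in [M + 4] serves [4 * s <= n]. *)
pose k := t.+2; pose A := t + 2 * (t.+1 * k); pose Q := (M + 4) * A ^ t.+1.
exists (2 ^ (k * Q) + M) => n ltn; have n0 : 0 < n by lia.
have k1 : 1 < 2 ^ k by rewrite -{1}(expn0 2) ltn_exp2l.
pose q := trunc_log (2 ^ k) n.
have leQ : Q <= q by apply: trunc_log_max => //; rewrite -expnM; lia.
have leq : 2 ^ (k * q) <= n by rewrite expnM trunc_logP.
have ltq : n < 2 ^ (k * q.+1) by rewrite expnM trunc_log_ltn.
(* Here [k * q.+1] is the [L] of [branching_remainder_le], since n < 2^(k(q+1)). *)
pose s := t + 2 * (t.+1 * (k * q.+1)).
have les : s <= A * q.+1.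
  by rewrite /s /A mulnDl -!mulnA leq_add2r leq_pmulr.
have leqq : q.+1 <= 2 ^ q by apply: ltn_expl.
have les2 : s <= A * 2 ^ q by apply: leq_trans les _; rewrite leq_mul2l leqq orbT.
have H : (M + 4) * s ^ t.+1 <= n.
  apply: leq_trans leq; apply: (@leq_trans ((M + 4) * (A * 2 ^ q) ^ t.+1)).
    by rewrite leq_mul2l leq_exp2r ?les2 ?orbT.
  rewrite expnMn mulnA -/Q [in leqRHS]mulnC expnM [leqRHS]expnS leq_mul2r.
  by rewrite (leq_trans leQ) ?orbT // ltnW.
have s1 : s <= s ^ t.+1 by rewrite -{1}(expn1 s); case: (s) => // s'; rewrite leq_pexp2l.
have le4 : 4 * s <= n.
  by apply: leq_trans H; apply: leq_mul s1; rewrite leq_addl.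
exists s; split=> //.
- exact: leq_addr.
- by apply: leq_trans (ltnW ltn); rewrite leq_addl.
- by apply: leq_trans H; rewrite leq_mul2r leq_addr orbT.
exact: branching_remainder_le le4 (ltnW ltq).
Qed.

(** * Matchings, and the number of perfect matchings through given edges *)

Section Matchings.

Variable n : nat.
Notation V := 'I_(2 * n).
Implicit Types (T P S m : {set {set V}}) (e : {set V}) (F : {set {set {set V}}}).

Definition matching T := [forall e in T, edge_of e] && trivIset T.

(** For a matching of t edges this is its canonically t-intersecting family. *)
Definition containing T := [set m | perfect_matching m & T \subset m].

Lemma matchingP T :
  reflect ((forall e, e \in T -> #|e| = 2) /\ trivIset T) (matching T).
Proof.
apply: (iffP andP) => [[/forall_inP h1 h2]|[h1 h2]]; split=> //.
  by move=> e /h1/eqP.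
by apply/forall_inP=> e /h1/eqP.
Qed.

Lemma card_cover_matching T : matching T -> #|cover T| = 2 * #|T|.
Proof.
move=> /matchingP[h2 /eqP<-].
by rewrite (eq_bigr (fun=> 2)) // sum_nat_const mulnC.
Qed.

Lemma card_matching_le T : matching T -> #|T| <= n.
Proof.
move=> mT; have := max_card (mem (cover T)).
by rewrite card_cover_matching // card_ord leq_pmul2l.
Qed.

Lemma sub_matching S T : S \subset T -> matching T -> matching S.
Proof.
move=> sST /matchingP[h2 tT]; apply/matchingP; split.
  by move=> e eS; apply/h2/(subsetP sST).
by apply/trivIsetP=> A B AS BS; move/trivIsetP: tT; apply; apply: (subsetP sST).
Qed.

Lemma matchingU1 e T : matching T -> #|e| = 2 -> [disjoint e & cover T] ->
  matching (e |: T) /\ e \notin T.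
Proof.
move=> /matchingP[h2 tT] e2 dis.
have d1 B : B \in T -> [disjoint e & B].
  by move=> BT; apply: disjointWr dis; apply: bigcup_sup.
have n0 : set0 \notin T by apply/negP=> /h2; rewrite cards0.
have [t1 nT] := trivIsetU1 d1 tT n0; split=> //.
by apply/matchingP; split=> // B /setU1P[-> //|/h2].
Qed.

Lemma disjoint_matching e T : matching T -> e \in T ->
  [disjoint e & cover (T :\ e)].
Proof.
move=> /matchingP[_ /trivIsetP tT] eT.
apply: bigcup_disjoint => B /setD1P[ne BT].
by apply: tT; rewrite 1?eq_sym.
Qed.

(** Disjoint edges cover 2|m| vertices, so covering all 2n of them amounts to |m| = n. *)
Lemma perfect_matchingE m : perfect_matching m = matching m && (#|m| == n).
Proof.
apply/andP/andP=> [[/forall_inP h2 /forallP h1]|[mm /eqP cm]].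
  have mm : matching m.
    apply/andP; split; first exact/forall_inP.
    apply/trivIsetP=> A B Am Bm; apply: contraNT => /pred0Pn[v /andP[/= vA vB]].
    have /cards1P[C EC] := h1 v.
    have : A \in [set e in m | v \in e] by rewrite inE Am.
    have : B \in [set e in m | v \in e] by rewrite inE Bm.
    by rewrite EC !inE => /eqP-> /eqP->.
  split=> //; have := card_cover_matching mm.
  suff -> : cover m = setT by rewrite cardsT card_ord => /eqP; rewrite eqn_pmul2l // eq_sym.
  apply/setP=> v; rewrite inE; apply/bigcupP.
  have /cards1P[C EC] := h1 v.
  have : C \in [set e in m | v \in e] by rewrite EC inE.
  by rewrite inE => /andP[? ?]; exists C.
have /matchingP[h2 tm] := mm; split; first by apply/forall_inP=> e /h2/eqP.
apply/forallP=> v.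
have cT : cover m = setT.
  by apply/eqP; rewrite eqEcard subsetT cardsT card_ord card_cover_matching // cm leqnn.
have /bigcupP[e em ve] : v \in cover m by rewrite cT.
apply/cards1P; exists e; apply/setP=> B; rewrite !inE.
apply/andP/eqP=> [[Bm vB]|->//].
apply/eqP; apply: contraTT (ve) => ne.
by move/trivIsetP: tm => /(_ _ _ Bm em ne) /disjointFr ->.
Qed.

Lemma perfect_matching_cover m : perfect_matching m -> cover m = setT.
Proof.
rewrite perfect_matchingE => /andP[mm /eqP cm]; apply/eqP.
by rewrite eqEcard subsetT cardsT card_ord card_cover_matching // cm leqnn.
Qed.

(** Induction on n - |T|: a vertex v not covered by [T] has 2k+1 possible partners w, and each
    choice adds the edge {v, w} to [T]. *)
Lemma card_containing T : matching T -> #|containing T| = oddfact (n - #|T|).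
Proof.
move Ek: (n - #|T|) => k.
elim: k T Ek => [|k IH] T Ek mT; have leT := card_matching_le mT.
  have cT : #|T| = n by lia.
  rewrite /oddfact big_ord0; apply/eqP/cards1P; exists T.
  apply/setP=> m; rewrite !inE perfect_matchingE.
  apply/andP/eqP=> [[/andP[_ /eqP cm] sTm]|->].
    by apply/esym/eqP; rewrite eqEcard sTm cm cT leqnn.
  by rewrite mT cT eqxx.
have [v vT] : exists v, v \notin cover T.
  apply/existsP; rewrite -negb_forall; apply/negP=> /forallP h.
  have : cover T = setT by apply/setP=> v; rewrite h inE.
  move/(congr1 (fun A : {set V} => #|A|)); rewrite card_cover_matching // cardsT card_ord; lia.
have -> : #|containing T| =
    \sum_(w in ~: (v |: cover T)) #|containing ([set v; w] |: T)|.
  rewrite -sum1_card.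
  (* Double counting: each matching through [T] gives v exactly one partner w. *)
  transitivity (\sum_(m in containing T)
     \sum_(w in ~: (v |: cover T)) ([set v; w] \in m)).
    apply: eq_bigr => m; rewrite inE => /andP[pm sTm].
    have /bigcupP[e em ve] : v \in cover m by rewrite perfect_matching_cover.
    move: pm; rewrite perfect_matchingE => /andP[/matchingP[h2 tm] _].
    have /cards2P[x [y [nxy exy]]] := introT eqP (h2 _ em).
    have [w nvw ew] : exists2 w, v != w & e = [set v; w].
      move: ve; rewrite exy !inE => /orP[]/eqP->; first by exists y.
      by exists x; rewrite 1?eq_sym // setUC.
    have eT : e \notin T.
      by apply: contraNN vT => eT; apply/bigcupP; exists e.
    have wT : w \in ~: (v |: cover T).
      rewrite !inE negb_or eq_sym nvw /=; apply/bigcupP=> -[B BT wB].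
      have Bm := subsetP sTm _ BT.
      have ne : B != e by apply: contraNneq eT => <-.
      move/trivIsetP: tm => /(_ _ _ Bm em ne) /disjointFr /(_ wB).
      by rewrite ew !inE eqxx orbT.
    rewrite (bigD1 w wT) -ew. rewrite /= em big1 // => u /andP[_ nuw].
    apply/eqP; rewrite eqb0; apply/negP=> um.
    have ne : [set v; u] != e.
      apply: contraNneq nuw => E; have : u \in e by rewrite -E !inE eqxx orbT.
      rewrite ew !inE => /orP[/eqP uv|//].
      by move: (h2 _ um); rewrite uv setUid cards1.
    move/trivIsetP: tm => /(_ _ _ um em ne) /disjointFr /(_ (set21 _ _)).
    by rewrite ve.
  rewrite exchange_big /=; apply: eq_bigr => w _.
  rewrite -sum1_card big_mkcond [RHS]big_mkcond /=; apply: eq_bigr => m _.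
  by rewrite !inE subUset sub1set; case: (perfect_matching m); case: (T \subset m); case: (_ \in m).
have cU : #|~: (v |: cover T)| = 2 * k + 1.
  have := cardsC (v |: cover T); rewrite cardsU1 vT card_cover_matching // card_ord; lia.
rewrite (eq_bigr (fun=> oddfact k)).
  by rewrite sum_nat_const cU /oddfact big_ord_recr /= mulnC.
move=> w; rewrite !inE negb_or => /andP[nwv wT].
have e2 : #|[set v; w]| = 2 by rewrite cards2 eq_sym nwv.
have dis : [disjoint [set v; w] & cover T].
  apply/pred0P=> x /=; rewrite !inE.
  by apply/negP=> /andP[/orP[]/eqP-> h]; [rewrite h in vT|rewrite h in wT].
have [mU nU] := matchingU1 mT e2 dis.
by apply: IH => //; rewrite cardsU1 nU; lia.
Qed.

(** A set that is not a matching lies in no perfect matching. Hence branching never has to check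
    that the chosen edges are disjoint. *)
Lemma card_containing_le T : #|containing T| <= oddfact (n - #|T|).
Proof.
have [mT|nT] := boolP (matching T); first by rewrite card_containing.
rewrite (_ : containing T = set0) ?cards0 //; apply/setP=> m; rewrite !inE.
apply/andP=> -[]; rewrite perfect_matchingE => /andP[mm _] /sub_matching/(_ mm).
exact/negP.
Qed.

(** * Covers, branching, and families without a common t-set *)

Definition containing_avoiding T P := [set m in containing T | [disjoint m & P]].

Definition covers t F S := [forall m in F, t <= #|m :&: S|].

(** [S] holds the edges chosen along a branch; [set0] is the root. *)
Definition uncovered t F s S :=
  [set m in F | (S \subset m) && ~~ [exists C : {set {set V}},
     [&& covers t F C, C \subset m & #|C| <= s]]].

(** [j] counts the branching steps left. If [S] is a cover, it is itself a small cover inside every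
    member containing it, so none is counted. Otherwise some [m1] in [F] has fewer than t edges in
    [S], and each member has an edge in [m1 :\: S], giving at most n branches. *)
Lemma card_uncovered_le t F S j :
    (forall m, m \in F -> perfect_matching m) -> t_intersecting t F ->
  #|uncovered t F (#|S| + j) S| <= n ^ j * oddfact (n - (#|S| + j)).
Proof.
move=> pF tF; elim: j S => [|j IH] S.
  rewrite mul1n addn0; apply: leq_trans (card_containing_le S).
  by apply/subset_leq_card/subsetP=> m; rewrite !inE => /andP[/pF-> /andP[->]].
have [cS|] := boolP (covers t F S).
  rewrite (_ : uncovered _ _ _ _ = set0) ?cards0 //; apply/setP=> m; rewrite !inE.
  apply/negP=> /and3P[_ sSm /existsP[]]; exists S; rewrite cS sSm; lia.
rewrite negb_forall_in => /exists_inP[m1 m1F]; rewrite -ltnNge => ltm1.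
have sub : uncovered t F (#|S| + j.+1) S \subset
    \bigcup_(e in m1 :\: S) uncovered t F (#|e |: S| + j) (e |: S).
  apply/subsetP=> m; rewrite inE => /and3P[mF sSm ncm].
  have lem : t <= #|m :&: m1|.
    by move/forall_inP: tF => /(_ _ mF)/forall_inP; apply.
  have /subsetPn[e /setIP[em em1] neS] : ~~ (m :&: m1 \subset m1 :&: S).
    apply/negP=> /subset_leq_card; lia.
  have eS : e \notin S by apply: contraNN neS => eS; rewrite inE em1.
  apply/bigcupP; exists e; first by rewrite inE eS.
  by rewrite inE mF subUset sub1set em sSm cardsU1 eS add1n addSnnS.
apply: leq_trans (subset_leq_card sub) _.
apply: leq_trans (leq_card_bigcup _ _) _.
have cm1 : #|m1 :\: S| <= n.
  apply: leq_trans (subset_leq_card (subsetDl _ _)) _.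
  by have := pF _ m1F; rewrite perfect_matchingE => /andP[_ /eqP->].
apply: (@leq_trans (\sum_(e in m1 :\: S) n ^ j * oddfact (n - (#|S| + j.+1)))).
  apply: leq_sum => e; rewrite inE => /andP[eS _].
  by have := IH (e |: S); rewrite cardsU1 eS add1n addSnnS.
by rewrite sum_nat_const expnS -mulnA leq_mul2r cm1 orbT.
Qed.

(** A matching avoiding [P :\ e] either contains [e], which then joins [T], or avoids [P]; this is
    the recursion of [avoid_count]. *)
Lemma card_containing_avoiding T P :
    matching (T :|: P) -> [disjoint T & P] ->
  INR #|containing_avoiding T P| = avoid_count #|P| (n - #|T|).
Proof.
move Ek: #|P| => k; elim: k T P Ek => [|k IH] T P Ek mTP dTP.
  have P0 : P = set0 by apply/eqP; rewrite -cards_eq0 Ek.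
  rewrite /= -card_containing; last by rewrite P0 setU0 in mTP.
  congr (INR #|pred_of_set _|); apply/setP=> m.
  by rewrite !inE P0 -setI_eq0 setI0 eqxx andbT.
have [e eP] : exists e, e \in P by apply/set0Pn; rewrite -cards_eq0 Ek.
have eT : e \notin T by rewrite (disjointFl dTP eP).
have cP : #|P :\ e| = k by have := cardsD1 e P; rewrite eP Ek => -[].
have dTPe : [disjoint T & P :\ e] by apply: disjointWr dTP; apply: subsetDl.
have mTPe : matching (T :|: (P :\ e)).
  by apply: sub_matching mTP; apply/setUS/subsetDl.
have mTeP : matching ((e |: T) :|: (P :\ e)).
  by rewrite (setUC [set e]) -setUA setD1K.
have dTeP : [disjoint e |: T & P :\ e].
  rewrite disjoint_sym disjoints_subset; apply/subsetP=> x.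
  by rewrite !inE negb_or => /andP[-> xP]; rewrite (disjointFl dTP xP).
have /= := IH _ _ cP mTPe dTPe.
rewrite -(cardsID [set m : {set {set V}} | e \in m]) plus_INR => <-.
have := IH _ _ cP mTeP dTeP; rewrite cardsU1 eT add1n subnS => <-.
rewrite (_ : _ :&: _ = containing_avoiding (e |: T) (P :\ e)); last first.
  apply/setP=> m; rewrite !inE subUset sub1set.
  by case: (perfect_matching m); case: (T \subset m); case: (e \in m);
    rewrite ?andbF ?andbT.
rewrite (_ : _ :\: _ = containing_avoiding T P); first by rewrite Rplus_minus_l.
apply/setP=> m; rewrite !inE.
have -> : [disjoint m & P] = (e \notin m) && [disjoint m & P :\ e].
  rewrite -{1}(setD1K eP) disjoint_sym disjoints_subset subUset sub1set.
  by rewrite -disjoints_subset inE disjoint_sym.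
by rewrite andbCA.
Qed.

(** A member through [T] shares t edges with [m0], not all of them in [T]. An extra one is disjoint
    from the edges of [T], so the member does not avoid the edges of [m0] disjoint from [T]. *)
Lemma card_containing_star_le t F T m0 :
    t_intersecting t F -> m0 \in F -> (forall m, m \in F -> perfect_matching m) ->
    matching T -> #|T| = t -> ~~ (T \subset m0) ->
  exists2 p, p <= n - t &
    (INR #|F :&: containing T| <=
      INR (oddfact (n - t)) - avoid_count p (n - t))%R.
Proof.
move=> tF m0F pF mT cT nT.
have := pF _ m0F; rewrite perfect_matchingE => /andP[mm0 _].
(* Edges of [m0] touching [T] are dropped so that [T :|: P] is a matching, as the exact count of
   avoiders requires. *)
pose P := [set e in m0 | [disjoint e & cover T]].
have dTP : [disjoint T & P].
  apply/pred0P=> e /=; apply/negP=> /andP[eT]; rewrite inE => /andP[_ /pred0P dis].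
  have /matchingP[/(_ _ eT) e2 _] := mT.
  have [x xe] : exists x, x \in e by apply/set0Pn; rewrite -cards_eq0 e2.
  by have := dis x; rewrite /= xe /=; case/negP; apply/bigcupP; exists e.
have mTP : matching (T :|: P).
  have /matchingP[T2 /trivIsetP tT] := mT.
  have /matchingP[m2 /trivIsetP tm] := mm0.
  apply/matchingP; split=> [e /setUP[/T2//|]|].
    by rewrite inE => /andP[/m2].
  have cross A B : A \in T -> B \in P -> [disjoint A & B].
    move=> AT; rewrite inE => /andP[_ dis]; rewrite disjoint_sym.
    by apply: disjointWr dis; apply: bigcup_sup.
  apply/trivIsetP=> A B /setUP[AT|AP] /setUP[BT|BP] ne.
  - exact: tT.
  - exact: cross.
  - by rewrite disjoint_sym; apply: cross.
  - by move: AP BP; rewrite !inE => /andP[Am _] /andP[Bm _]; apply: tm.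
have cTP : #|P| <= n - t.
  have := card_matching_le mTP; rewrite cardsU (_ : T :&: P = set0) ?cards0.
    by rewrite cT subn0 => leTP; rewrite leq_subRL ?(leq_trans _ leTP) ?leq_addr.
  by apply/eqP; rewrite setI_eq0.
exists #|P| => //.
rewrite -cT -card_containing // -card_containing_avoiding //.
have sub : containing_avoiding T P \subset containing T.
  by apply/subsetP=> m; rewrite inE => /andP[].
have := cardsID (containing_avoiding T P) (containing T).
rewrite (setIidPr sub) => <-; rewrite plus_INR.
set a := INR _; set b := INR #|containing_avoiding _ _|.
suff : (a <= INR #|containing T :\: containing_avoiding T P|)%R by lra.
apply/le_INR/leP/subset_leq_card/subsetP=> m /setIP[mF mcT].
rewrite inE mcT andbT inE mcT /=; apply/negP=> dis.
have : t <= #|m :&: m0|.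
  by move/forall_inP: tF => /(_ _ mF)/forall_inP; apply.
have : #|T :&: m0| < t.
  by rewrite -cT; apply: proper_card; rewrite properEneq subsetIl andbT; apply: contraNneq nT => /setIidPl.
move=> lt le; have /subsetPn[e /setIP[em em0] neT] : ~~ (m :&: m0 \subset T :&: m0).
  by apply/negP=> /subset_leq_card /(leq_trans le); rewrite leqNgt lt.
have eT : e \notin T by apply: contraNN neT => eT; rewrite inE eT.
have eP : e \in P.
  rewrite inE em0 /=; apply: bigcup_disjoint => B BT.
  move: mcT; rewrite inE perfect_matchingE => /andP[/andP[/matchingP[_ /trivIsetP tm] _] sTm].
  by apply: tm => //; [apply: (subsetP sTm)|apply: contraNneq eT => ->].
by rewrite (disjointFr dis em) in eP.
Qed.

(** The summands bound, in order, the second branching, the members containing no small cover, and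
    the members through a t-set common to all small covers. *)
Lemma card_nontrivial_le t s F :
    (forall m, m \in F -> perfect_matching m) -> t_intersecting t F ->
    (forall T, #|T| = t -> exists2 m, m \in F & ~~ (T \subset m)) ->
  exists2 p, p <= n - t &
    (INR #|F| <= INR (s ^ t.+1 * oddfact (n - t.+1))
      + INR (n ^ s * oddfact (n - s))
      + (INR (oddfact (n - t)) - avoid_count p (n - t)))%R.
Proof.
move=> pF tF ntF.
have cR : #|uncovered t F s set0| <= n ^ s * oddfact (n - s).
  by have := card_uncovered_le set0 s pF tF; rewrite cards0 add0n.
have R1 := pos_INR (s ^ t.+1 * oddfact (n - t.+1)).
have R2 := pos_INR (n ^ s * oddfact (n - s)).
have [/existsP[S0 /andP[cS0 leS0]]|] :=
  boolP [exists C : {set {set V}}, covers t F C && (#|C| <= s)]; last first.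
  (* With p = 0 the last summand vanishes. *)
  move=> noC; exists 0 => //.
  have -> : #|F| = #|uncovered t F s set0|.
    congr #|pred_of_set _|; apply/setP=> m; rewrite !inE sub0set /=.
    case: (m \in F) => //=; apply/esym; apply: contraNN noC.
    by case/existsP=> C /and3P[h1 _ h2]; apply/existsP; exists C; rewrite h1.
  by have := le_INR _ _ (leP cR); rewrite /=; lra.
have meetS0 C m : covers t F C -> m \in F -> t <= #|m :&: C|.
  by move=> /forall_inP h /h.
have [/existsP[T /andP[/eqP cT /forall_inP allT]]|noT] :=
  boolP [exists T : {set {set V}}, (#|T| == t) &&
    [forall C in [set C : {set {set V}} | covers t F C && (#|C| <= s)], T \subset C]].
  have subF : F \subset (F :&: containing T) :|: uncovered t F s set0.
    apply/subsetP=> m mF; rewrite inE; case: (boolP (m \in uncovered _ _ _ _)) => [|nu].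
      by rewrite orbT.
    rewrite orbF inE mF inE pF //=; move: nu; rewrite inE mF sub0set /= negbK.
    case/existsP=> C /and3P[h1 sCm h2]; apply: subset_trans sCm; apply: allT.
    by rewrite inE h1.
  have leF : #|F| <= #|F :&: containing T| + n ^ s * oddfact (n - s).
    apply: leq_trans (subset_leq_card subF) _.
    by apply: leq_trans (leq_card_setU _ _) _; rewrite leq_add2l.
  have := le_INR _ _ (leP leF); rewrite plus_INR.
  have [m0 m0F nT] := ntF _ cT.
  have [mT|nmT] := boolP (matching T).
    have [p lep H] := card_containing_star_le tF m0F pF mT cT nT.
    by exists p => //; lra.
  rewrite (_ : F :&: containing T = set0) ?cards0 /=.
    by exists 0 => //=; lra.
  apply/setP=> m; rewrite !inE; apply/negP=> /and3P[_].
  by rewrite perfect_matchingE => /andP[mm _] /sub_matching/(_ mm); apply/negP.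
exists 0 => //; rewrite [avoid_count _ _]/=.
suff leF : #|F| <= s ^ t.+1 * oddfact (n - t.+1).
  by have := le_INR _ _ (leP leF); lra.
(* Second branching: each member contains one of at most s^t t-subsets [T] of the cover [S0]. A
   small cover [C] not containing [T] then forces a further edge in [C :\: T], with at most s
   choices. *)
have subF : F \subset \bigcup_(T in [set T : {set {set V}} | T \subset S0 & #|T| == t])
    (F :&: containing T).
  apply/subsetP=> m mF; have /card_geqP[r [ur sr rS]] := meetS0 _ _ cS0 mF.
  have sub : [set x in r] \subset m :&: S0 by apply/subsetP=> x; rewrite inE => /rS.
  apply/bigcupP; exists [set x in r].
    by rewrite inE (subset_trans sub (subsetIr _ _)) cardsE (card_uniqP ur) sr eqxx.
  by rewrite inE mF inE pF // (subset_trans sub (subsetIl _ _)).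
apply: leq_trans (subset_leq_card subF) _.
apply: leq_trans (leq_card_bigcup _ _) _.
apply: (@leq_trans (\sum_(T in [set T : {set {set V}} | T \subset S0 & #|T| == t])
    s * oddfact (n - t.+1))); last first.
  rewrite sum_nat_const cards_draws expnSr -mulnA leq_mul2r.
  rewrite (leq_trans (leq_bin_expn _ _)) ?orbT //.
  by case: (t) => // k; rewrite leq_exp2r.
apply: leq_sum => T; rewrite inE => /andP[_ /eqP cT].
move: noT; rewrite negb_exists => /forallP/(_ T); rewrite cT eqxx /=.
rewrite negb_forall_in => /exists_inP[C]; rewrite inE => /andP[cC leC] nTC.
have subT : F :&: containing T \subset \bigcup_(e in C :\: T) containing (e |: T).
  apply/subsetP=> m /setIP[mF]; rewrite inE => /andP[pm sTm].
  have lt : #|T :&: C| < t.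
    by rewrite -cT; apply: proper_card; rewrite properEneq subsetIl andbT; apply: contraNneq nTC => /setIidPl.
  have /subsetPn[e /setIP[em eC] ne] : ~~ (m :&: C \subset T :&: C).
    by apply/negP=> /subset_leq_card /(leq_trans (meetS0 _ _ cC mF)); rewrite leqNgt lt.
  have eT : e \notin T by apply: contraNN ne => eT; rewrite inE eT.
  by apply/bigcupP; exists e; rewrite !inE ?eT // pm subUset sub1set em.
apply: leq_trans (subset_leq_card subT) _.
apply: leq_trans (leq_card_bigcup _ _) _.
apply: (@leq_trans (\sum_(e in C :\: T) oddfact (n - t.+1))).
  apply: leq_sum => e; rewrite inE => /andP[eT _].
  by have := card_containing_le (e |: T); rewrite cardsU1 eT cT.
rewrite sum_nat_const leq_mul2r (leq_trans _ leC) ?orbT //.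
exact/subset_leq_card/subsetDl.
Qed.

End Matchings.

(** * Asymptotics for large n *)

Theorem mainTheorem8 (t : nat) (eps : R) :
  (0 < eps < 1 / sqrt (exp 1))%R ->
  exists n0 : nat, forall n : nat, n0 < n ->
  forall F : {set {set {set 'I_(2 * n)}}},
    (forall m, m \in F -> perfect_matching m) ->
    t_intersecting t F ->
    (INR #|F| > (1 - 1 / sqrt (exp 1) + eps) * INR (oddfact (n - t)))%R ->
    exists T : {set {set 'I_(2 * n)}},
      [/\ #|T| = t,
          (forall e, e \in T -> edge_of e),
          (forall e e', e \in T -> e' \in T -> e != e' -> [disjoint e & e']) &
          (forall m, m \in F -> T \subset m)].
Proof.
have eh : (1 / sqrt (exp 1) = exp (- (1 / 2)))%R.
  have -> : (exp 1 = exp (1 / 2) * exp (1 / 2))%R by rewrite -exp_plus; congr exp; lra.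
  rewrite sqrt_square; last exact/Rlt_le/exp_pos.
  by rewrite exp_Ropp /Rdiv Rmult_1_l.
rewrite eh => -[eps0 epse].
have ehlt1 : (exp (- (1 / 2)) < 1)%R.
  by have := @exp_increasing (- (1 / 2)) 0; rewrite exp_0; apply; lra.
(* Three error terms, each at most 1/M times [oddfact (n - t)], must stay below [eps]. *)
have [M Meps] := INR_unbounded (3 / eps).
have [n0 Hn0] := branching_depth t M.
(* With 4t <= n, having n > 4 yields both [0 < N] and M <= n <= 2N for N = n - t - 1. *)
exists (n0 + 4) => n ltn F pF tF largeF.
have [s [lets le4s leMn leMs ler]] := Hn0 n (leq_ltn_trans (leq_addr _ _) ltn).
have ofpos k : (0 < INR (oddfact k))%R.
  by apply: (lt_INR 0); apply/ltP/prodn_gt0 => i; rewrite addn1.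
have [/existsP[T /andP[/eqP cT /forall_inP TF]]|noT] :=
  boolP [exists T : {set {set 'I_(2 * n)}}, (#|T| == t) && [forall m in F, T \subset m]].
  (* [T] inherits its edges and their disjointness from any member of [F], which exists because the
     lower bound on |F| is positive. *)
  have [m mF] : exists m, m \in F.
    apply/set0Pn/eqP=> F0; move: largeF; rewrite F0 cards0 /=.
    by have := ofpos (n - t); nra.
  have := pF _ mF; rewrite perfect_matchingE => /andP[mm _].
  have /matchingP[T2 /trivIsetP tT] := sub_matching (TF _ mF) mm.
  exists T; split=> // e eT; by [rewrite /edge_of T2|apply: tT].
exfalso; apply: (Rgt_not_le _ _ largeF).
have ntF (T : {set {set 'I_(2 * n)}}) : #|T| = t -> exists2 m, m \in F & ~~ (T \subset m).
  move=> cT; apply/exists_inP; rewrite -negb_forall_in; apply: contraNN noT => h.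
  by apply/existsP; exists T; rewrite cT eqxx.
have [p lep leF] := card_nontrivial_le s pF tF ntF.
have [N eN] : exists N, n - t = N.+1 by exists (n - t).-1; lia.
have N0 : 0 < N by lia.
have eN' : n - t.+1 = N by lia.
rewrite eN in lep leF ler *; rewrite eN' in leF.
have := avoid_count_ge N0 lep.
have MR : (0 < INR M)%R by apply: Rlt_trans Meps; apply: Rdiv_lt_0_compat; lra.
have leM3 : (3 * / INR M < eps)%R.
  apply: (Rmult_lt_reg_r (INR M)) => //; rewrite Rmult_assoc Rinv_l; last lra.
  have := Rmult_lt_compat_r _ _ _ eps0 Meps; rewrite /Rdiv Rmult_assoc Rinv_l; lra.
set O := INR (oddfact N.+1) in leF *; have O0 : (0 < O)%R by apply: ofpos.
have small1 : (/ (2 * INR N) <= / INR M)%R.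
  apply: Rinv_le_contravar => //; rewrite -[2%R]/(INR 2) -mult_INR.
  by apply/le_INR; lia.
(* The ratio of [oddfact N.+1] to [oddfact N] is 2N+1 >= n >= M s^(t+1). *)
have small2 : (INR (s ^ t.+1 * oddfact N) <= / INR M * O)%R.
  apply: (Rmult_le_reg_l (INR M)) => //; rewrite -Rmult_assoc Rinv_r; last lra.
  rewrite Rmult_1_l -mult_INR /O; apply/le_INR/leP.
  by rewrite multE oddfactS mulnA leq_mul2r (leq_trans leMs) ?orbT //; lia.
have small3 : (INR (n ^ s * oddfact (n - s)) <= / INR M * O)%R.
  apply: (Rmult_le_reg_l (INR M)) => //; rewrite -Rmult_assoc Rinv_r; last lra.
  rewrite Rmult_1_l -mult_INR /O; apply/le_INR/leP.
  by rewrite multE; apply: leq_trans ler; rewrite leq_mul2r leMn orbT.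
have := Rmult_le_compat_r _ _ _ (Rlt_le _ _ O0) small1.
have := Rmult_lt_compat_r _ _ _ O0 leM3.
lra.
Qed.
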